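(* Let $n\ge 0$ be an integer and let $tt$ be a natural number with $0\le tt<2^{2^n}$ (viewed as the $2^n$-bit truth table of an $n$-variable boolean function). With the functions $\mathrm{plain\_bdd}$, $\mathrm{plain\_inverse\_bdd}$, $\mathrm{bdd}$ and $\mathrm{ev}$ defined in the context, the complete binary tree of depth $n$ obtained by recursive application of $\mathrm{bitmerge\_unpair}$ to $tt$, i.e. $\mathrm{plain\_bdd}(n,tt)$, is an (unreduced) BDD that evaluates back to the truth table. Precisely: $$\mathrm{plain\_inverse\_bdd}(\mathrm{plain\_bdd}(n,tt)) = tt,$$ $$\mathrm{ev}(\mathrm{plain\_bdd}(n,tt)) = tt .$$ Moreover, $\mathrm{ev}$ also acts as a left inverse of $\mathrm{bdd}$ (the reduced BDD): $$\mathrm{ev}(\mathrm{bdd}(n,tt)) = tt .$$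
   Context: Natural numbers include $0$. Every natural number $N$ is identified with its binary expansion $N=\sum_{i\ge 0} N_i 2^i$, $N_i\in\{0,1\}$. The operations $\oplus$ and $\&$ denote bitwise exclusive-or and bitwise conjunction of natural numbers. **Pairing and unpairing.** For a natural number $N$, $\mathrm{bitmerge\_unpair}(N)=(a,b)$, where $a=\sum_{i} N_{2i}2^i$ collects the bits of $N$ in even positions and $b=\sum_i N_{2i+1}2^i$ collects the bits of $N$ in odd positions. For natural numbers $a,b$, $\mathrm{bitmerge\_pair}(a,b)=\sum_i a_i 2^{2i}+\sum_i b_i 2^{2i+1}$. **Trees and BDDs.** A tree is either a leaf $C(c)$ with $c$ a natural number, or an internal node $D(v,l,r)$ with $v$ a natural number (variable index) and $l,r$ trees. A BDD is a pair $\mathrm{BDD}(n,t)$ of a natural number $n$ (the number of variables) and a tree $t$. In a node $D(v,l,r)$ the subtree $l$ is the THEN branch and $r$ is the ELSE branch of a decision on variable $v$. **Unreduced BDD.** Define $\mathrm{shf}(0,N)=C(N)$ and, for $n\ge 1$, $\mathrm{shf}(n,N)=D(n-1,\ \mathrm{shf}(n-1,a),\ \mathrm{shf}(n-1,b))$ where $(a,b)=\mathrm{bitmerge\_unpair}(N)$. For $0\le tt<2^{2^n}$, $\mathrm{plain\_bdd}(n,tt)=\mathrm{BDD}(n,\mathrm{shf}(n,tt))$. **Structural inverse.** Define $\mathrm{rshf}(C(c))=c$ and $\mathrm{rshf}(D(v,l,r))=\mathrm{bitmerge\_pair}(\mathrm{rshf}(l),\mathrm{rshf}(r))$; then $\mathrm{plain\_inverse\_bdd}(\mathrm{BDD}(n,t))=\mathrm{rshf}(t)$.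 **Reduced BDD.** Define $\mathrm{reduce}(C(c))=C(c)$; $\mathrm{reduce}(D(v,l,r))=\mathrm{reduce}(l)$ if $l=r$ (syntactic equality of trees); and $\mathrm{reduce}(D(v,l,r))=D(v,\mathrm{reduce}(l),\mathrm{reduce}(r))$ otherwise. Then $\mathrm{bdd}(n,tt)=\mathrm{BDD}(n,\mathrm{reduce}(\mathrm{shf}(n,tt)))$ for $0\le tt<2^{2^n}$. **Boolean evaluation.** For fixed $n$ put $m=2^{2^n}-1$, and for $0\le k<n$ let $x_k=\lfloor m/(2^{2^{n-k-1}}+1)\rfloor$ (the bitvector encoding the $k$-th boolean variable). Let $\mathrm{ite}(x,t,e)=((t\oplus e)\,\&\,x)\oplus e$. Define, for trees with all leaves in $\{C(0),C(1)\}$ and all variable indices in $\{0,\dots,n-1\}$, $\mathrm{eval}_n(C(0))=0$, $\mathrm{eval}_n(C(1))=m$, and $\mathrm{eval}_n(D(k,l,r))=\mathrm{ite}(x_k,\mathrm{eval}_n(l),\mathrm{eval}_n(r))$. Then $\mathrm{ev}(\mathrm{BDD}(n,t))=\mathrm{eval}_n(t)$. *)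

(* Defs.v *)
From Stdlib Require Import Arith List.

(** A sum [sum_{i >= 0} B_i w_i] over the bits of a number [N] is truncated to
    [i < N]: as [N < 2 ^ N], all bits of [N] in positions [>= N] vanish. *)

Definition bit (N i : nat) : nat := Nat.b2n (Nat.testbit N i).

Definition sum_below (N : nat) (f : nat -> nat) : nat :=
  list_sum (map f (seq 0 N)).

Definition bitmerge_unpair (N : nat) : nat * nat :=
  (sum_below N (fun i => bit N (2 * i) * 2 ^ i),
   sum_below N (fun i => bit N (2 * i + 1) * 2 ^ i)).

Definition bitmerge_pair (a b : nat) : nat :=
  sum_below a (fun i => bit a i * 2 ^ (2 * i)) +
  sum_below b (fun i => bit b i * 2 ^ (2 * i + 1)).

(** In [D v l r], [l] is the THEN branch and [r] the ELSE branch. *)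
Inductive tree : Set :=
| C (c : nat)
| D (v : nat) (l r : tree).

Inductive bdd_with_arity : Set :=
| BDD (n : nat) (t : tree).

Definition tree_eq_dec (s t : tree) : {s = t} + {s <> t}.
Proof. decide equality; apply Nat.eq_dec. Defined.

Fixpoint shf (n N : nat) : tree :=
  match n with
  | 0 => C N
  | S n' =>
      let (a, b) := bitmerge_unpair N in
      D n' (shf n' a) (shf n' b)
  end.

Definition plain_bdd (n tt : nat) : bdd_with_arity := BDD n (shf n tt).

Fixpoint rshf (t : tree) : nat :=
  match t with
  | C c => c
  | D _ l r => bitmerge_pair (rshf l) (rshf r)
  end.

Definition plain_inverse_bdd (B : bdd_with_arity) : nat :=
  match B with BDD _ t => rshf t end.

Fixpoint reduce (t : tree) : tree :=
  match t with
  | C c => C c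
  | D v l r =>
      if tree_eq_dec l r then reduce l else D v (reduce l) (reduce r)
  end.

Definition bdd (n tt : nat) : bdd_with_arity := BDD n (reduce (shf n tt)).

Definition full_table (n : nat) : nat := 2 ^ (2 ^ n) - 1.

Definition var_table (n k : nat) : nat :=
  full_table n / (2 ^ (2 ^ (n - k - 1)) + 1).

Definition ite (x t e : nat) : nat :=
  Nat.lxor (Nat.land (Nat.lxor t e) x) e.

(** Evaluation is a partial function: it is [None] exactly when some leaf is
    not [C 0] or [C 1], or some variable index is not below [n]. *)
Fixpoint eval (n : nat) (t : tree) : option nat :=
  match t with
  | C 0 => Some 0
  | C 1 => Some (full_table n)
  | C _ => None
  | D k l r =>
      if k <? n then
        match eval n l, eval n r with
        | Some el, Some er => Some (ite (var_table n k) el er)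
        | _, _ => None
        end
      else None
  end.

Definition ev (B : bdd_with_arity) : option nat :=
  match B with BDD n t => eval n t end.

(* Main.v *)
Require Import Defs.
From Stdlib Require Import Arith List Lia Bool.

(** Put [p = n - j] for a level [0 <= j <= n].  The word [eval n (shf j N)] has
    [2 ^ n] bits, the [i]-th of which is the bit [i / 2 ^ p] of [N]: each bit of
    [N] is repeated [2 ^ p] times.  Indeed [var_table n (j - 1)] selects exactly
    the positions [i] whose own binary digit number [p] is [0], that is, those
    with [i / 2 ^ p] even, and the THEN branch of [shf j N] holds the bits of [N]
    in even positions.  For [j = n] this is the truth table itself.  Reduction is
    harmless because [ite x e e = e]. *)

(** * Binary digits of sums of distinct powers of two *)

Lemma testbit_b2n_mul_pow2 (b : bool) (k j : nat) :
  Nat.testbit (Nat.b2n b * 2 ^ k) j = (k =? j) && b.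
Proof.
  destruct b; cbn [Nat.b2n].
  - now rewrite Nat.mul_1_l, Nat.pow2_bits_eqb, andb_true_r.
  - now rewrite Nat.mul_0_l, Nat.bits_0, andb_false_r.
Qed.

(** Without a common digit no carry occurs, so addition is xor, which here agrees with or. *)
Lemma add_disjoint (a b : nat) :
  (forall j, Nat.testbit a j && Nat.testbit b j = false) ->
  a + b = Nat.lor a b.
Proof.
  intros H.
  assert (Hand : Nat.land a b = 0).
  { apply Nat.bits_inj; intros j. now rewrite Nat.land_spec, Nat.bits_0. }
  now rewrite Nat.add_nocarry_lxor, Nat.lxor_lor.
Qed.

(** Injectivity of [p] keeps the summands on disjoint digits, so each addition is an or. *)
Lemma testbit_sum_below (p : nat -> nat) (f : nat -> bool) (N j : nat) :
  (forall x y, p x = p y -> x = y) ->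
  Nat.testbit (sum_below N (fun i => Nat.b2n (f i) * 2 ^ p i)) j =
  existsb (fun i => (p i =? j) && f i) (seq 0 N).
Proof.
  (* The start of the range varies, because the tail of [seq s N] starts at [S s]. *)
  intros Hp. unfold sum_below. enough (H : forall s,
    Nat.testbit (list_sum (map (fun i => Nat.b2n (f i) * 2 ^ p i) (seq s N))) j =
    existsb (fun i => (p i =? j) && f i) (seq s N)) by apply H.
  revert j; induction N as [|N IH]; intros j s; cbn [seq map existsb].
  - apply Nat.bits_0.
  - change (list_sum (?x :: ?l)) with (x + list_sum l).
    rewrite add_disjoint.
    + now rewrite Nat.lor_spec, testbit_b2n_mul_pow2, IH.
    + intros k. rewrite testbit_b2n_mul_pow2, IH.
      apply not_true_is_false; intros H.
      apply andb_prop in H as [H1 H2]. apply andb_prop in H1 as [H1 _].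
      apply existsb_exists in H2 as [i [Hi H2]]. apply andb_prop in H2 as [H2 _].
      apply Nat.eqb_eq in H1, H2. apply in_seq in Hi.
      assert (i = s) by (apply Hp; congruence). lia.
Qed.

Lemma existsb_position (p : nat -> nat) (f : nat -> bool) (N k : nat) :
  (forall x y, p x = p y -> x = y) -> (N <= k -> f k = false) ->
  existsb (fun i => (p i =? p k) && f i) (seq 0 N) = f k.
Proof.
  intros Hp Hk. apply eq_true_iff_eq. rewrite existsb_exists. split.
  - intros [i [_ H]]. apply andb_prop in H as [H1 H2].
    apply Nat.eqb_eq, Hp in H1. now subst i.
  - intros H. exists k. split.
    + apply in_seq. destruct (Nat.le_gt_cases N k) as [Hle|Hlt]; [|lia].
      rewrite (Hk Hle) in H. discriminate.
    + now rewrite Nat.eqb_refl.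
Qed.

Lemma existsb_no_position (p : nat -> nat) (f : nat -> bool) (N j : nat) :
  (forall x, p x <> j) ->
  existsb (fun i => (p i =? j) && f i) (seq 0 N) = false.
Proof.
  intros Hj. apply not_true_is_false; intros H.
  apply existsb_exists in H as [i [_ H]]. apply andb_prop in H as [H _].
  apply Nat.eqb_eq in H. now apply (Hj i).
Qed.

Lemma testbit_large (N i : nat) : N <= i -> Nat.testbit N i = false.
Proof.
  intros H. destruct (Nat.eq_dec N 0) as [->|HN]; [apply Nat.bits_0|].
  apply Nat.bits_above_log2. pose proof (Nat.log2_lt_lin N). lia.
Qed.

Lemma testbit_lt_pow2 (N k i : nat) :
  N < 2 ^ k -> k <= i -> Nat.testbit N i = false.
Proof.
  intros HN Hi. rewrite <- (Nat.mod_small N (2 ^ k)) by easy.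
  now apply Nat.mod_pow2_bits_high.
Qed.

(** * Pairing and unpairing digit by digit *)

Lemma testbit_unpair_fst (N i : nat) :
  Nat.testbit (fst (bitmerge_unpair N)) i = Nat.testbit N (2 * i).
Proof.
  cbn [fst bitmerge_unpair]. unfold bit.
  rewrite (testbit_sum_below (fun i => i) (fun i => Nat.testbit N (2 * i))) by easy.
  apply (existsb_position (fun i => i) (fun i => Nat.testbit N (2 * i))); [easy|].
  intros H. apply testbit_large. lia.
Qed.

Lemma testbit_unpair_snd (N i : nat) :
  Nat.testbit (snd (bitmerge_unpair N)) i = Nat.testbit N (2 * i + 1).
Proof.
  cbn [snd bitmerge_unpair]. unfold bit.
  rewrite (testbit_sum_below (fun i => i) (fun i => Nat.testbit N (2 * i + 1))) by easy.
  apply (existsb_position (fun i => i) (fun i => Nat.testbit N (2 * i + 1))); [easy|].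
  intros H. apply testbit_large. lia.
Qed.

(** One sum occupies only even positions and the other only odd ones, so at each position a single
    sum contributes. *)
Lemma testbit_pair (a b i : nat) :
  Nat.testbit (bitmerge_pair a b) (2 * i) = Nat.testbit a i /\
  Nat.testbit (bitmerge_pair a b) (2 * i + 1) = Nat.testbit b i.
Proof.
  unfold bitmerge_pair, bit.
  assert (Ha : forall j, Nat.testbit (sum_below a
      (fun i => Nat.b2n (Nat.testbit a i) * 2 ^ (2 * i))) j =
      existsb (fun i => (2 * i =? j) && Nat.testbit a i) (seq 0 a)).
  { intros j. apply (testbit_sum_below (fun i => 2 * i) (Nat.testbit a)). lia. }
  assert (Hb : forall j, Nat.testbit (sum_below b
      (fun i => Nat.b2n (Nat.testbit b i) * 2 ^ (2 * i + 1))) j =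
      existsb (fun i => (2 * i + 1 =? j) && Nat.testbit b i) (seq 0 b)).
  { intros j. apply (testbit_sum_below (fun i => 2 * i + 1) (Nat.testbit b)). lia. }
  rewrite add_disjoint.
  - rewrite !Nat.lor_spec, !Ha, !Hb. split.
    + rewrite (existsb_no_position (fun i => 2 * i + 1)) by lia.
      rewrite orb_false_r.
      apply (existsb_position (fun i => 2 * i)); [lia|apply testbit_large].
    + rewrite (existsb_no_position (fun i => 2 * i)) by lia.
      apply (existsb_position (fun i => 2 * i + 1)); [lia|apply testbit_large].
  - intros j. rewrite Ha, Hb. destruct (Nat.Even_or_Odd j) as [[k ->]|[k ->]].
    + rewrite (existsb_no_position (fun i => 2 * i + 1)) by lia. apply andb_false_r.
    + now rewrite (existsb_no_position (fun i => 2 * i)) by lia.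
Qed.

Lemma bitmerge_pair_unpair (N : nat) :
  bitmerge_pair (fst (bitmerge_unpair N)) (snd (bitmerge_unpair N)) = N.
Proof.
  apply Nat.bits_inj; intros j.
  destruct (Nat.Even_or_Odd j) as [[k ->]|[k ->]].
  - now rewrite (proj1 (testbit_pair _ _ k)), testbit_unpair_fst.
  - now rewrite (proj2 (testbit_pair _ _ k)), testbit_unpair_snd.
Qed.

Lemma shf_succ (n N : nat) :
  shf (S n) N =
  D n (shf n (fst (bitmerge_unpair N))) (shf n (snd (bitmerge_unpair N))).
Proof. reflexivity. Qed.

Lemma rshf_shf (n N : nat) : rshf (shf n N) = N.
Proof.
  revert N; induction n as [|n IH]; intros N; [reflexivity|].
  rewrite shf_succ. cbn [rshf]. rewrite !IH. apply bitmerge_pair_unpair.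
Qed.

(** * Digits of the variable tables *)

Lemma testbit_full_table (n i : nat) :
  Nat.testbit (full_table n) i = (i <? 2 ^ n).
Proof.
  unfold full_table. rewrite Nat.sub_1_r, <- Nat.ones_equiv.
  destruct (Nat.ltb_spec i (2 ^ n)).
  - now apply Nat.ones_spec_low.
  - now apply Nat.ones_spec_high.
Qed.

(** Difference of squares: [X ^ 2 - 1 = (X - 1) * (X + 1)] with [X = 2 ^ 2 ^ n]. *)
Lemma full_table_succ (n : nat) :
  full_table (S n) = full_table n * (2 ^ 2 ^ n + 1).
Proof.
  unfold full_table. rewrite Nat.pow_succ_r', Nat.mul_comm, Nat.pow_mul_r.
  pose proof (Nat.pow_nonzero 2 (2 ^ n)). cbn [Nat.pow].
  generalize dependent (2 ^ 2 ^ n). intros. nia.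
Qed.

Lemma var_table_top (p : nat) : full_table (S p) / (2 ^ 2 ^ p + 1) = full_table p.
Proof. rewrite full_table_succ. apply Nat.div_mul. lia. Qed.

(** Makes the division defining [var_table] exact, so that it commutes with multiplication by
    further factors. *)
Lemma full_table_divide (p d : nat) :
  Nat.divide (2 ^ 2 ^ p + 1) (full_table (d + S p)).
Proof.
  induction d as [|d IH].
  - exists (full_table p). apply full_table_succ.
  - cbn [Nat.add]. rewrite full_table_succ. now apply Nat.divide_mul_l.
Qed.

(** The sum is two adjacent copies of the [K]-digit word [x]. *)
Lemma testbit_add_high (x K i : nat) :
  x < 2 ^ K ->
  Nat.testbit (x + x * 2 ^ K) i =
  if i <? K then Nat.testbit x i else Nat.testbit x (i - K).
Proof.
  intros Hx. destruct (Nat.ltb_spec i K) as [Hi|Hi].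
  - rewrite <- (Nat.mod_pow2_bits_low (x + x * 2 ^ K) K i) by easy.
    rewrite Nat.Div0.mod_add, Nat.mod_small by easy. reflexivity.
  - replace i with (i - K + K) at 1 by lia.
    rewrite <- Nat.div_pow2_bits, Nat.div_add, Nat.div_small by lia. reflexivity.
Qed.

(** Here [d] is the variable index and [p] the number of variables after it. Raising [d] by one
    multiplies the exact quotient by [2 ^ 2 ^ n + 1] with [n = d + S p], which places a second copy
    of the pattern above the first. *)
Lemma testbit_full_table_div (p d i : nat) :
  Nat.testbit (full_table (d + S p) / (2 ^ 2 ^ p + 1)) i =
  (i <? 2 ^ (d + S p)) && negb (Nat.testbit i p).
Proof.
  revert i; induction d as [|d IH]; intros i.
  - cbn [Nat.add]. rewrite var_table_top, testbit_full_table, Nat.pow_succ_r'.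
    pose proof (Nat.pow_nonzero 2 p).
    destruct (Nat.ltb_spec i (2 * 2 ^ p)); destruct (Nat.ltb_spec i (2 ^ p));
      cbn [andb]; try lia.
    + now rewrite (testbit_lt_pow2 i p).
    + rewrite Nat.testbit_eqb.
      replace (i / 2 ^ p) with 1; [reflexivity|].
      apply (Nat.div_unique i (2 ^ p) 1 (i - 2 ^ p)); lia.
  - destruct (full_table_divide p d) as [x Hx].
    cbn [Nat.add]. set (n := d + S p) in *.
    assert (Hn : full_table n < 2 ^ 2 ^ n).
    { unfold full_table. pose proof (Nat.pow_nonzero 2 (2 ^ n)). lia. }
    rewrite full_table_succ.
    rewrite Hx in IH. rewrite Nat.div_mul in IH by lia.
    rewrite Hx.
    replace (x * (2 ^ 2 ^ p + 1) * (2 ^ 2 ^ n + 1))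
      with ((x + x * 2 ^ 2 ^ n) * (2 ^ 2 ^ p + 1)) by ring.
    rewrite Nat.div_mul, testbit_add_high by nia.
    rewrite Nat.pow_succ_r'.
    destruct (Nat.ltb_spec i (2 ^ n)) as [Hi|Hi]; rewrite IH.
    + destruct (Nat.ltb_spec i (2 ^ n)), (Nat.ltb_spec i (2 * 2 ^ n)); try lia.
      reflexivity.
    + f_equal.
      * destruct (Nat.ltb_spec (i - 2 ^ n) (2 ^ n)), (Nat.ltb_spec i (2 * 2 ^ n));
          lia.
      * f_equal.
        (* As [p < n], digit [p] depends only on the residue modulo [2 ^ n], which the shift by
           [2 ^ n] preserves. *)
        rewrite <- (Nat.mod_pow2_bits_low i n p) by (unfold n; lia).
        rewrite <- (Nat.mod_pow2_bits_low (i - 2 ^ n) n p) by (unfold n; lia).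
        f_equal. replace i with (i - 2 ^ n + 1 * 2 ^ n) at 2 by lia.
        now rewrite Nat.Div0.mod_add.
Qed.

Lemma testbit_var_table (n k i : nat) :
  k < n ->
  Nat.testbit (var_table n k) i =
  (i <? 2 ^ n) && negb (Nat.testbit i (n - k - 1)).
Proof.
  intros Hk. unfold var_table.
  pose proof (testbit_full_table_div (n - k - 1) k i) as H.
  now replace (k + S (n - k - 1)) with n in H by lia.
Qed.

(** * Evaluation and reduction *)

(** Where [x] has digit 1 the two occurrences of [e] cancel; where it has digit 0 only the outer [e]
    survives. *)
Lemma testbit_ite (x t e i : nat) :
  Nat.testbit (ite x t e) i =
  if Nat.testbit x i then Nat.testbit t i else Nat.testbit e i.
Proof.
  unfold ite. rewrite Nat.lxor_spec, Nat.land_spec, Nat.lxor_spec.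
  now destruct (Nat.testbit x i), (Nat.testbit t i), (Nat.testbit e i).
Qed.

Lemma ite_same (x e : nat) : ite x e e = e.
Proof.
  apply Nat.bits_inj; intros i. rewrite testbit_ite. now destruct Nat.testbit.
Qed.

Lemma eval_shf (n j N : nat) :
  j <= n -> (forall i, 2 ^ j <= i -> Nat.testbit N i = false) ->
  exists e, eval n (shf j N) = Some e /\
    forall i, Nat.testbit e i = (i <? 2 ^ n) && Nat.testbit N (i / 2 ^ (n - j)).
Proof.
  revert N; induction j as [|j IH]; intros N Hj HN.
  (* At level 0 only digit 0 of [N] can be set, so the leaf is [C 0] or [C 1] and evaluation is
     defined. *)
  - assert (HN1 : N = Nat.b2n (Nat.testbit N 0)).
    { apply Nat.bits_inj; intros [|i].
      - now rewrite Nat.b2n_bit0.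
      - rewrite HN by (cbn; lia).
        symmetry. destruct (Nat.testbit N 0); apply Nat.bits_0. }
    rewrite Nat.sub_0_r.
    destruct (Nat.testbit N 0); cbn [Nat.b2n] in HN1; subst N; cbn [shf eval].
    + exists (full_table n). split; [reflexivity|]. intros i.
      rewrite testbit_full_table.
      destruct (Nat.ltb_spec i (2 ^ n)); [|reflexivity].
      now rewrite Nat.div_small.
    + exists 0. split; [reflexivity|]. intros i.
      now rewrite !Nat.bits_0, andb_false_r.
  - rewrite Nat.pow_succ_r' in HN.
    destruct (IH (fst (bitmerge_unpair N))) as [l [Hl Hlb]]; [lia| |].
    { intros i Hi. rewrite testbit_unpair_fst. apply HN. lia. }
    destruct (IH (snd (bitmerge_unpair N))) as [r [Hr Hrb]]; [lia| |].
    { intros i Hi. rewrite testbit_unpair_snd. apply HN. lia. }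
    exists (ite (var_table n j) l r). split.
    { rewrite shf_succ. cbn [eval]. rewrite Hl, Hr.
      destruct (Nat.ltb_spec j n); [reflexivity|lia]. }
    intros i. rewrite testbit_ite, testbit_var_table, Hlb, Hrb by lia.
    destruct (i <? 2 ^ n); cbn [andb]; [|reflexivity].
    rewrite testbit_unpair_fst, testbit_unpair_snd.
    replace (n - j) with (S (n - S j)) by lia.
    replace (n - j - 1) with (n - S j) by lia.
    replace (S (n - S j) - 1) with (n - S j) by lia.
    set (p := n - S j).
    (* With [q = i / 2 ^ p], digit [p] of [i] is the parity of [q], and the subtrees are read at
       [q / 2]. The selected branch thus reads digit [2 * (q / 2)] or [2 * (q / 2) + 1] of [N],
       which is digit [q] in either case. *)
    rewrite Nat.pow_succ_r', (Nat.mul_comm 2 (2 ^ p)), <- Nat.Div0.div_div.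
    rewrite Nat.testbit_eqb. set (q := i / 2 ^ p).
    pose proof (Nat.div_mod_eq q 2) as Hq.
    pose proof (Nat.mod_upper_bound q 2 ltac:(lia)).
    destruct (Nat.eqb_spec (q mod 2) 1); cbn [negb]; f_equal; lia.
Qed.

(** A collapsed node has branches of equal value, on which [ite] is constant. Only this direction
    holds: collapsing may discard an out-of-range variable and turn [None] into a value. *)
Lemma eval_reduce (n : nat) (t : tree) (e : nat) :
  eval n t = Some e -> eval n (reduce t) = Some e.
Proof.
  revert e; induction t as [c|v l IHl r IHr]; intros e; [easy|].
  cbn [eval reduce].
  destruct (v <? n) eqn:Hv; [|discriminate].
  destruct (eval n l) as [el|] eqn:Hl; [|discriminate].
  destruct (eval n r) as [er|] eqn:Hr; [|discriminate].
  intros [= <-]. destruct (tree_eq_dec l r) as [<-|_].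
  - rewrite Hl in Hr. injection Hr as <-. rewrite ite_same. now apply IHl.
  - cbn [eval]. now rewrite Hv, (IHl el), (IHr er).
Qed.

Theorem proposition3 (n tt : nat) (Htt : tt < 2 ^ (2 ^ n)) :
  plain_inverse_bdd (plain_bdd n tt) = tt /\
  ev (plain_bdd n tt) = Some tt /\
  ev (bdd n tt) = Some tt.
Proof.
  assert (Hev : eval n (shf n tt) = Some tt).
  { destruct (eval_shf n n tt) as [e [He Hb]]; [easy| |].
    - intros i. now apply testbit_lt_pow2.
    - rewrite He. f_equal. apply Nat.bits_inj; intros i.
      rewrite Hb, Nat.sub_diag, Nat.pow_0_r, Nat.div_1_r.
      (* At [j = n] each digit is repeated once; beyond the word, [Htt] makes the digits of [tt]
         vanish too. *)
      destruct (Nat.ltb_spec i (2 ^ n)); [reflexivity|].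
      symmetry. now apply (testbit_lt_pow2 tt (2 ^ n)). }
  split; [|split].
  - apply rshf_shf.
  - exact Hev.
  - now apply eval_reduce.
Qed.
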